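(* Let $\mathcal A=\{h_1,h_2,h_3,h_4\}$ be the arrangement in $\mathbb R^3$ of the planes spanned by the four faces of a regular tetrahedron, and let $V_q$ be its $15\times15$ $q$-Varchenko matrix, with the regions ordered as in the context. Then the Smith normal form of $V_q$ over $\mathbb Z[q]$ is $$\mathrm{diag}\big(1,\ (1-q^2)I_4,\ (1-q^2)^2I_6,\ (1-q^2)^3I_4\big),$$ with left and right transition matrices $P$ and $P^t$, i.e. $PV_qP^t$ equals this diagonal matrix, where, with block sizes $1,4,4,2,4$, $$P=\begin{pmatrix}1&0&0&0&0\\ -q\mathbf 1&I_4&0&0&0\\ q^2\mathbf 1&-q(I+J)&I_4&0&0\\ q^2\mathbf 1&-q(I_2\,|\,I_2)&0&I_2&0\\ -q^3\mathbf 1&q^2(I+J+J^2)&-q(I+J)&-q(I_2\,|\,I_2)^t&I_4\end{pmatrix}.$$ Here $\mathbf 1$ denotes a column of ones of the appropriate length, $I=I_4$, $(I_2\,|\,I_2)=\begin{pmatrix}1&0&1&0\\ 0&1&0&1\end{pmatrix}$ and $J=\begin{pmatrix}0&1&0&0\\ 0&0&1&0\\ 0&0&0&1\\ 1&0&0&0\end{pmatrix}$.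
   Context: For a hyperplane arrangement, the regions are the connected components of the complement of the union of the hyperplanes; $sep(R,R')$ is the set of hyperplanes separating $R$ from $R'$. The $q$-Varchenko matrix $V_q$ is indexed by the regions, with $(R,R')$-entry $q^{\#sep(R,R')}$. $R_0$ is the interior of the tetrahedron. A region $R$ is denoted by the string of indices of the planes in $sep(R_0,R)$ (with $0$ denoting $R_0$). The 15 regions, in order, are: $0$; $1,2,3,4$; $12,23,34,14$; $13,24$; $123,234,341,412$. A Smith normal form over $\mathbb Z[q]$ of an $m\times m$ matrix $M$ over $\mathbb Z[q]$ is a diagonal matrix $D=\mathrm{diag}(d_1,\dots,d_m)$ with $d_k\mid d_{k+1}$ in $\mathbb Z[q]$ for all $k$ and $D=AMB$ with $A,B\in GL_m(\mathbb Z[q])$; $A$ and $B$ are the left and right transition matrices. *)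

(* Defs.v *)
(* MathComp / MathComp-Analysis. *)
From HB Require Import structures.
From mathcomp Require Import all_boot all_order all_algebra.
From mathcomp Require Import all_classical all_reals all_analysis.

Set Implicit Arguments.
Unset Strict Implicit.
Unset Printing Implicit Defensive.

Import Order.TTheory GRing.Theory Num.Theory numFieldNormedType.Exports.

Local Open Scope classical_set_scope.
Local Open Scope ring_scope.

(* Hyperplane arrangements. An arrangement is an indexed family
   h : 'I_m -> set 'rV[R]_n of pairwise distinct hyperplanes; sets of
   hyperplanes of the arrangement are represented by their sets of indices. *)

Definition regions (T : topologicalType) (m : nat) (h : 'I_m -> set T) :
    set (set T) :=
  connected_component (~` \bigcup_i h i) @` (~` \bigcup_i h i).

Definition dotr (R : realType) (n : nat) (x y : 'rV[R]_n) : R :=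
  \sum_i x ord0 i * y ord0 i.

(* H is a hyperplane, and C, C' lie in its two opposite open half-spaces.
   Replacing (u, c) by (- u, - c) shows that this is symmetric in C, C'. *)
Definition separates (R : realType) (n : nat) (H C C' : set 'rV[R]_n) : Prop :=
  exists (u : 'rV[R]_n) (c : R),
    [/\ u != 0,
        H = [set x | dotr u x = c],
        C `<=` [set x | dotr u x < c] &
        C' `<=` [set x | c < dotr u x]].

Definition sep (R : realType) (n m : nat) (h : 'I_m -> set 'rV[R]_n)
    (C C' : set 'rV[R]_n) : {set 'I_m} :=
  finset (fun i => `[< separates (h i) C C' >]).

(* Z[q] is {poly int}, with q = 'X; reg enumerates the regions, in the order
   used to index rows and columns. *)
Definition varchenko (R : realType) (n m N : nat) (h : 'I_m -> set 'rV[R]_n)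
    (reg : 'I_N -> set 'rV[R]_n) : 'M[{poly int}]_N :=
  \matrix_(i, j) 'X^#|sep h (reg i) (reg j)|.

(* Smith normal forms. *)

(* The library's %| on {poly int} is divisibility up to a nonzero constant
   (2 *: 'X divides 'X); this is divisibility in the ring itself. *)
Definition dvd_in (A : comPzRingType) (a b : A) : Prop := exists c, b = c * a.

Definition smith_normal_form_with (A : comUnitRingType) (m : nat)
    (M D P Q : 'M[A]_m) : Prop :=
  [/\ is_diag_mx D,
      forall k l : 'I_m, l = k.+1 :> nat -> dvd_in (D k k) (D l l),
      P \in unitmx, Q \in unitmx &
      D = P *m M *m Q].

(* Tetrahedra. *)

Definition eucl_dist (R : realType) (n : nat) (x y : 'rV[R]_n) : R :=
  Num.sqrt (dotr (x - y) (x - y)).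

Definition affinely_independent (R : realType) (n m : nat)
    (v : 'I_m -> 'rV[R]_n) : Prop :=
  forall a : 'I_m -> R,
    \sum_i a i = 0 -> \sum_i a i *: v i = 0 -> forall i, a i = 0.

Definition regular_tetrahedron (R : realType) (v : 'I_4 -> 'rV[R]_3) : Prop :=
  affinely_independent v /\
  exists l : R, forall i j, i != j -> eucl_dist (v i) (v j) = l.

Definition affine_span (R : realType) (n m : nat) (v : 'I_m -> 'rV[R]_n)
    (S : {set 'I_m}) : set 'rV[R]_n :=
  [set x | exists a : 'I_m -> R,
     \sum_(i in S) a i = 1 /\ x = \sum_(i in S) a i *: v i].

Definition convex_span (R : realType) (n m : nat) (v : 'I_m -> 'rV[R]_n) :
    set 'rV[R]_n :=
  [set x | exists a : 'I_m -> R,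
     [/\ forall i, 0 <= a i, \sum_i a i = 1 & x = \sum_i a i *: v i]].

(* Faces are indexed by their opposite vertices. *)
Definition face_plane (R : realType) (v : 'I_4 -> 'rV[R]_3) (k : 'I_4) :
    set 'rV[R]_3 :=
  affine_span v (~: [set k])%SET.

Definition tetra_interior (R : realType) (v : 'I_4 -> 'rV[R]_3) :
    set 'rV[R]_3 :=
  interior (convex_span v).

(* Planes are numbered from 1 in the strings, from 0 in 'I_4. The empty string
   stands for the interior of the tetrahedron. *)
Definition region_strings : seq (seq nat) :=
  [:: [::];
      [:: 1]; [:: 2]; [:: 3]; [:: 4];
      [:: 1; 2]; [:: 2; 3]; [:: 3; 4]; [:: 1; 4];
      [:: 1; 3]; [:: 2; 4];
      [:: 1; 2; 3]; [:: 2; 3; 4]; [:: 3; 4; 1]; [:: 4; 1; 2]]%N.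

Definition region_label (i : 'I_15) : {set 'I_4} :=
  finset (fun k : 'I_4 => k.+1 \in nth [::] region_strings i).

Definition region_ordering (R : realType) (v : 'I_4 -> 'rV[R]_3)
    (reg : 'I_15 -> set 'rV[R]_3) : Prop :=
  [/\ set_bij [set: 'I_15] (regions (face_plane v)) reg,
      reg ord0 = tetra_interior v &
      forall i, sep (face_plane v) (tetra_interior v) (reg i) = region_label i].

(* The explicit matrices. *)

Definition J4 : 'M[{poly int}]_4 :=
  \matrix_(i, j) (nat_of_ord j == (i.+1 %% 4)%N)%:R.

Definition I2I2 : 'M[{poly int}]_(2, 2 + 2) := row_mx 1%:M 1%:M.

Definition ones (n : nat) : 'cV[{poly int}]_n := const_mx 1.

Definition P_tetra : 'M[{poly int}]_(1 + (4 + (4 + (2 + 4)))) :=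
  let q : {poly int} := 'X in
  let J2 := J4 *m J4 in
  col_mx (row_mx 1%:M
         (row_mx 0
         (row_mx 0
         (row_mx 0 0))))
 (col_mx (row_mx (- q *: ones 4)
         (row_mx 1%:M
         (row_mx 0
         (row_mx 0 0))))
 (col_mx (row_mx (q ^+ 2 *: ones 4)
         (row_mx (- q *: (1%:M + J4))
         (row_mx 1%:M
         (row_mx 0 0))))
 (col_mx (row_mx (q ^+ 2 *: ones 2)
         (row_mx (- q *: I2I2)
         (row_mx 0
         (row_mx 1%:M 0))))
         (row_mx (- q ^+ 3 *: ones 4)
         (row_mx (q ^+ 2 *: (1%:M + J4 + J2))
         (row_mx (- q *: (1%:M + J4))
         (row_mx (- q *: I2I2^T) 1%:M))))))).

Definition D_tetra : 'M[{poly int}]_(1 + (4 + (6 + 4))) :=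
  let q : {poly int} := 'X in
  diag_mx (row_mx (const_mx 1)
          (row_mx (const_mx (1 - q ^+ 2))
          (row_mx (const_mx ((1 - q ^+ 2) ^+ 2))
                  (const_mx ((1 - q ^+ 2) ^+ 3))))).

(* Main.v *)
(* Barycentric coordinates turn the four planes into coordinate hyperplanes
   meeting the affine hyperplane of total weight 1, so the regions are the sign
   cells indexed by the sets S of negative coordinates, all S but the full set
   occurring, and sep is symmetric difference. Over the whole Boolean lattice
   the Varchenko matrix is the 4-fold tensor power of [[1, q], [q, 1]], which
   [[1, 0], [-q, 1]] diagonalizes by congruence to diag(1, 1 - q^2). The tensor
   power of [[1, 0], [-q, 1]] vanishes at (S, T) unless T is a subset of S, so
   deleting the full set, a maximal element, preserves the identity; P is the
   resulting 15 x 15 matrix. *)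
Require Import Defs.
From HB Require Import structures.
From mathcomp Require Import all_boot all_order all_algebra.
From mathcomp Require Import ring lra.
From mathcomp Require Import all_classical all_reals all_analysis.

Set Implicit Arguments.
Unset Strict Implicit.
Unset Printing Implicit Defensive.

Import Order.TTheory GRing.Theory Num.Theory numFieldNormedType.Exports.

Local Open Scope classical_set_scope.
Local Open Scope ring_scope.

(** * Tensor powers over the Boolean lattice *)

Section BooleanKernels.
Variables (A : comPzRingType) (I : finType).
Implicit Types (S T : {set I}) (f g : bool -> bool -> A).

(* Entry (S, T) of the tensor power, over I, of the 2 x 2 matrix f. *)
Definition tensor f S T : A := \prod_k f (k \in S) (k \in T).

(** Mixed-product rule for Kronecker powers: distributing a product over [k] of two-term sums
    amounts to choosing, for each [k], whether it lies in [U]. *)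
Lemma tensor_mul f g S T :
  \sum_(U : {set I}) tensor f S U * tensor g U T =
  tensor (fun a b => f a true * g true b + f a false * g false b) S T.
Proof.
rewrite /tensor bigA_distr; apply: eq_bigr => U _.
by rewrite -big_split; apply: eq_bigr => k _ /=; case: ifP.
Qed.

Lemma tensor_tr f S T : tensor f S T = tensor (fun a b => f b a) T S.
Proof. by []. Qed.

(** The matrix [[1, 0], [x, 1]], with [false] as the first index. *)
Definition down_kernel (x : A) (a b : bool) : A :=
  if b then a%:R else if a then x else 1.

Lemma tensor_sub (x : A) S T :
  tensor (down_kernel x) S T =
  if T \subset S then x ^+ #|S :\: T| else 0.
Proof.
case: ifPn => [/fintype.subsetP TS|].
  rewrite -prodr_const [RHS]big_mkcond; apply: eq_bigr => k _.
  rewrite !inE; case: (boolP (k \in T)) => [/TS ->|] //=.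
case/subsetPn => k kT kS; apply/eqP.
by rewrite /tensor (bigD1 k) //= kT (negbTE kS) mul0r.
Qed.

Lemma tensor_symdiff (x : A) S T :
  tensor (fun a b => if a == b then 1 else x) S T =
  x ^+ #|(S :\: T) :|: (T :\: S)|.
Proof.
rewrite -prodr_const [RHS]big_mkcond; apply: eq_bigr => k _.
by rewrite !inE; case: (k \in S); case: (k \in T).
Qed.

Lemma tensor_diag (x : A) S T :
  tensor (fun a b => if a == b then (if a then x else 1) else 0) S T =
  (x ^+ #|S|) *+ (S == T).
Proof.
have [<-|/eqP/setP ST] := eqVneq S T.
  rewrite -prodr_const [RHS]big_mkcond; apply: eq_bigr => k _.
  by rewrite eqxx.
have [k kST] : exists k, (k \in S) != (k \in T).
  apply/existsP; apply: contrapT => /negP; rewrite negb_exists => /forallP e.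
  by apply: ST => k; apply/eqP; rewrite -[_ == _]negbK e.
by rewrite /tensor (bigD1 k) //= (negbTE kST) mul0r.
Qed.

Lemma eq_tensor f g S T : f =2 g -> tensor f S T = tensor g S T.
Proof. by move=> fg; apply: eq_bigr => k _; apply: fg. Qed.

End BooleanKernels.

(** * The matrices of the tetrahedron *)

Lemma region_label_neqT i : region_label i != [set: 'I_4]%SET.
Proof.
apply/eqP => /setP e.
have {e} : all (fun k => k.+1 \in nth [::] region_strings i) (iota 0 4).
  by apply/allP => k; rewrite mem_iota => /= k4; move: (e (Ordinal k4)); rewrite !inE.
by case: i; do 15?[case=> //].
Qed.

Lemma region_label_surj (S : {set 'I_4}) :
  S != [set: 'I_4]%SET -> exists i, region_label i = S.
Proof.
pose b k := inord k \in S => ST.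
have bE (k : 'I_4) : (k \in S) = b k by rewrite /b inord_val.
(* Membership in [S] is now four Booleans [b 0], ..., [b 3], so a matching string is found by
   computation in every case but all true. *)
pose agree (s : seq nat) := all (fun k => (k.+1 \in s) == b k) (iota 0 4).
have: has agree region_strings.
  have: ~~ all b (iota 0 4).
    apply: contra ST => /allP bT; apply/eqP/setP => k.
    by rewrite inE bE bT // mem_iota /=.
  rewrite /agree /=.
  by case: (b 0%N); case: (b 1%N); case: (b 2%N); case: (b 3%N).
move=> agreeS; have ltn15 := agreeS; rewrite has_find in ltn15.
exists (Ordinal ltn15); apply/setP => k; rewrite inE bE.
have /allP /(_ k) := nth_find [::] agreeS.
by rewrite mem_iota /= => /(_ (ltn_ord k)) /eqP.
Qed.

Lemma region_label_imset : (region_label @: [set: 'I_15] = [set~ [set: 'I_4]])%SET.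
Proof.
apply/setP => S; rewrite !inE; apply/imsetP/idP => [[i _ ->]|].
  exact: region_label_neqT.
by case/region_label_surj => i <-; exists i.
Qed.

(** By counting: the image, all subsets but the full one, has 2^4 - 1 = 15 elements, as many as the
    domain. *)
Lemma region_label_inj : injective region_label.
Proof.
suff: {in [set: 'I_15]%SET &, injective region_label} by move=> + i j; apply.
apply/imset_injP; rewrite region_label_imset cardsC1 cardsT card_ord.
by rewrite -cardsT -powersetT card_powerset cardsT card_ord.
Qed.

Lemma sum_region_label (A : nmodType) (F : {set 'I_4} -> A) :
  F [set: 'I_4]%SET = 0 -> \sum_i F (region_label i) = \sum_S F S.
Proof.
move=> FT; rewrite [RHS](bigD1 [set: 'I_4]%SET) //= FT add0r.
transitivity (\sum_(S in (region_label @: [set: 'I_15])%SET) F S).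
  rewrite big_imset /=; last by move=> i j _ _; apply: region_label_inj.
  by apply: eq_bigl => i; rewrite inE.
by apply: eq_bigl => S; rewrite region_label_imset !inE.
Qed.

Lemma card_region_label i :
  #|region_label i| = size (nth [::] region_strings i).
Proof.
rewrite -sum1dep_card big_mkcond !big_ord_recl big_ord0.
by case: i => n /=; do 15?[case: n => [|n] //].
Qed.

Lemma J4_sqrE i j :
  (J4 *m J4) i j = (nat_of_ord j == (i.+2 %% 4)%N)%:R.
Proof.
have k4 : (i.+1 %% 4 < 4)%N by rewrite ltn_mod.
rewrite mxE (bigD1 (Ordinal k4)) //= big1 => [|k /negbTE neq]; last first.
  by rewrite !mxE [_ == _]neq mul0r.
by rewrite !mxE eqxx mul1r addr0 /= -[X in (X %% _)%N]addn1 modnDml addn1.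
Qed.

Lemma I2I2E i j : I2I2 i j = (nat_of_ord i == (j %% 2)%N)%:R.
Proof.
rewrite /I2I2; case: (split_ordP j) => l ->; rewrite (row_mxEl, row_mxEr) mxE.
  by rewrite /= modn_small.
by rewrite /= modnDl modn_small.
Qed.

(** The fourth tensor power of [f] with the row and column of the full set deleted. *)
Definition region_kernel (A : comPzRingType) (f : bool -> bool -> A) : 'M[A]_15 :=
  \matrix_(i, j) tensor f (region_label i) (region_label j).

Lemma subset_region_label i j :
  (region_label i \subset region_label j) =
  all (fun k => k \in nth [::] region_strings j) (nth [::] region_strings i).
Proof.
apply/fintype.subsetP/allP => ij k ki.
  (* Letters lie between 1 and 4, so each is the successor of an index in ['I_4]. *)
  have /(all_nthP [::])/(_ i (ltn_ord i))/allP/(_ k ki) :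
    all (all (fun k => 0 < k <= 4)%N) region_strings by [].
  by case: k ki => // k ki /= k4; have := ij (Ordinal k4); rewrite !inE; apply.
by move: ki; rewrite !inE; apply: ij.
Qed.

(** Reduces each entry to a computation on strings, for the entrywise comparison with [P_tetra]. *)
Lemma region_down_kernelE (A : comPzRingType) (x : A) i j :
  region_kernel (down_kernel x) i j =
  if all (mem (nth [::] region_strings i)) (nth [::] region_strings j) then
    x ^+ (size (nth [::] region_strings i) - size (nth [::] region_strings j))
  else 0.
Proof.
rewrite mxE tensor_sub subset_region_label.
case: ifP => //; rewrite -subset_region_label => ji.
by rewrite cardsDS // !card_region_label.
Qed.

Lemma P_tetraE : (P_tetra : 'M[{poly int}]_15) = region_kernel (down_kernel (- 'X)).
Proof.
(* The columns of I2I2 are split as 2 + 2. *)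
suff PE (i : 'I_(1 + (4 + (4 + (2 + 4))))) (j : 'I_(1 + (4 + (4 + (2 + (2 + 2)))))) :
    (P_tetra : 'M[{poly int}]_(_, _)) i j = region_kernel (down_kernel (- 'X)) i j.
  by apply/matrixP => i j; apply: PE.
rewrite region_down_kernelE /P_tetra.
case: (split_ordP i) => [k ->|{}i ->];
  last case: (split_ordP i) => [k ->|{}i ->];
  last case: (split_ordP i) => [k ->|{}i ->];
  last case: (split_ordP i) => [k ->|k ->].
all: case: (split_ordP j) => [l ->|{}j ->];
  last case: (split_ordP j) => [l ->|{}j ->];
  last case: (split_ordP j) => [l ->|{}j ->];
  last case: (split_ordP j) => [l ->|l ->].
(* Each of the 25 blocks is checked entrywise: at numeral indices both sides become explicit
   polynomials in q. *)
all: rewrite ?(col_mxEu, col_mxEd, row_mxEl, row_mxEr).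
all: rewrite ?(I2I2E, J4_sqrE, mxE).
all: case: k => [[|[|[|[|k]]]] k4] //=.
all: case: l => [[|[|[|[|l]]]] l4] //=.
all: ring.
Qed.

(** The block with exponent r collects the binomial(4, r) strings of length r. *)
Lemma D_tetraE : (D_tetra : 'M[{poly int}]_15) =
  \matrix_(i, j) ((1 - 'X ^+ 2) ^+ #|region_label i| *+ (i == j)).
Proof.
suff DE (i j : 'I_(1 + (4 + (6 + 4)))) : (D_tetra : 'M[{poly int}]_(_, _)) i j =
    (1 - 'X ^+ 2) ^+ size (nth [::] region_strings i) *+ (i == j).
  by apply/matrixP => i j; rewrite [RHS]mxE card_region_label; apply: DE.
rewrite /D_tetra mxE; congr (_ *+ _).
case: (split_ordP i) => [k ->|{}i ->];
  last case: (split_ordP i) => [k ->|{}i ->];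
  last case: (split_ordP i) => [k ->|k ->].
all: rewrite ?(row_mxEl, row_mxEr) mxE.
all: by case: k => [[|[|[|[|[|[|k]]]]]] k4].
Qed.

(* The product over 'I_15 omits the full set from the sum over all subsets; the
   hypothesis makes its term vanish. *)
Lemma mulmx_region_kernel (A : comPzRingType) (f g : bool -> bool -> A) :
  f false true = 0 \/ g true false = 0 ->
  region_kernel f *m region_kernel g =
  region_kernel (fun a b => f a true * g true b + f a false * g false b).
Proof.
have missing i : exists k, k \notin region_label i.
  have /subsetPn[k _ ki] : ~~ ([set: 'I_4]%SET \subset region_label i).
    by rewrite finset.subTset region_label_neqT.
  by exists k.
move=> fg; apply/matrixP => i j; rewrite !mxE -tensor_mul -sum_region_label.
  by apply: eq_bigr => k _; rewrite !mxE.
(* The full set contains [k] and the label does not, so the factor at [k] is the vanishing entry. *)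
case: fg => fg0.
  have [k ki] := missing i.
  by rewrite /tensor (bigD1 k) //= (negbTE ki) inE fg0 !mul0r.
have [k kj] := missing j.
by rewrite /tensor [X in _ * X](bigD1 k) //= (negbTE kj) inE fg0 mul0r mulr0.
Qed.

Lemma mxdiag_varchenko :
  P_tetra *m region_kernel (fun a b => if a == b then 1 else 'X) *m P_tetra^T
  = D_tetra :> 'M[{poly int}]_15.
Proof.
have trP (f : bool -> bool -> {poly int}) :
    (region_kernel f)^T = region_kernel (fun a b => f b a).
  by apply/matrixP => i j; rewrite !mxE tensor_tr.
(* The left factor is lower triangular and the right one upper triangular, so both products may skip
   the full set; a 2 x 2 identity remains. *)
rewrite P_tetraE D_tetraE trP mulmx_region_kernel; last by left.
rewrite mulmx_region_kernel; last by right.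
apply/matrixP => i j; rewrite !mxE -(inj_eq region_label_inj) -tensor_diag.
by apply: eq_tensor => -[] [] /=; ring.
Qed.

(** [[1, 0], [-q, 1]] has inverse [[1, 0], [q, 1]] over Z[q], and restricted tensor powers of lower
    triangular matrices multiply factorwise. *)
Lemma unit_P_tetra : (P_tetra : 'M[{poly int}]_15) \in unitmx.
Proof.
rewrite P_tetraE.
suff /mulmx1_unit[] : region_kernel (down_kernel (- 'X : {poly int})) *m
    region_kernel (down_kernel 'X) = 1%:M by [].
rewrite mulmx_region_kernel; last by left.
apply/matrixP => i j; rewrite !mxE -(inj_eq region_label_inj).
(* Presents the identity matrix as the case [x = 1] of [tensor_diag]. *)
transitivity ((1 : {poly int}) ^+ #|region_label i|
  *+ (region_label i == region_label j)); last by rewrite expr1n.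
rewrite -tensor_diag.
by apply: eq_tensor => -[] [] /=; ring.
Qed.

Lemma is_diag_D_tetra : is_diag_mx (D_tetra : 'M[{poly int}]_15).
Proof. exact: diag_mx_is_diag. Qed.

(** The exponents are string lengths, which never decrease along the list. *)
Lemma dvd_D_tetra (k l : 'I_15) : l = k.+1 :> nat ->
  dvd_in ((D_tetra : 'M[{poly int}]_15) k k) ((D_tetra : 'M[{poly int}]_15) l l).
Proof.
rewrite D_tetraE !mxE !eqxx !card_region_label !mulr1n => lk.
exists ((1 - 'X ^+ 2) ^+ (size (nth [::] region_strings l)
  - size (nth [::] region_strings k))).
rewrite -exprD subnK // lk.
have : (k.+1 < 15)%N by rewrite -lk.
by move: (nat_of_ord k); do 15?[case=> //].
Qed.

(** * Cells of a hyperplane arrangement *)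

Lemma convex_comb_gt0 (R : realDomainType) (x y t : R) :
  0 < x -> 0 < y -> 0 <= t <= 1 -> 0 < (1 - t) * x + t * y.
Proof.
move=> x0 y0 /andP[t0]; rewrite le_eqVlt => /predU1P[->|t1].
  by rewrite subrr mul0r add0r mul1r.
by apply: ltr_wpDr; [exact/mulr_ge0/ltW|rewrite mulr_gt0 ?subr_gt0].
Qed.

Section AffineForms.
Variables (R : realType) (n : nat).
Implicit Types (u x y : 'rV[R]_n) (c t : R).

Definition affine_form u c x : R := dotr u x + c.

Lemma dotrDZ u x y t : dotr u (x + t *: y) = dotr u x + t * dotr u y.
Proof.
rewrite /dotr mulr_sumr -big_split; apply: eq_bigr => i _ /=.
by rewrite !mxE; ring.
Qed.

Lemma dotr_ge0 u : 0 <= dotr u u.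
Proof. by apply: sumr_ge0 => i _; rewrite -expr2 sqr_ge0. Qed.

Lemma dotr_gt0 u : u != 0 -> 0 < dotr u u.
Proof.
rewrite lt_neqAle dotr_ge0 andbT; apply: contra => /eqP/esym/psumr_eq0P u0.
apply/eqP/rowP => i; apply/eqP; rewrite mxE -(sqrf_eq0 (u _ _)) expr2.
by rewrite u0// => j _; rewrite -expr2 sqr_ge0.
Qed.

Lemma dotrNl u x : dotr (- u) x = - dotr u x.
Proof. by rewrite -sumrN; apply: eq_bigr => i _; rewrite mxE mulNr. Qed.

Lemma affine_form_segment u c x y t :
  affine_form u c (x + t *: (y - x)) =
  (1 - t) * affine_form u c x + t * affine_form u c y.
Proof.
by rewrite /affine_form -[- x]scaleN1r !dotrDZ mulN1r; ring.
Qed.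

Lemma continuous_affine_form u c : continuous (affine_form u c).
Proof.
suff dotr_cont : continuous (dotr u).
  by move=> x; apply: continuousD; [exact: dotr_cont|exact: cst_continuous].
apply: continuous_big => [|i _ x]; first exact: add_continuous.
by apply: continuousM; [exact: cst_continuous|exact: coord_continuous].
Qed.

End AffineForms.

Section Arrangement.
Variables (R : realType) (n m : nat) (a : 'I_m -> 'rV[R]_n) (b : 'I_m -> R).
Implicit Types (S T : {set 'I_m}) (x y : 'rV[R]_n).

Definition hyperplane k : set 'rV[R]_n := [set x | affine_form (a k) (b k) x = 0].

(* The sign vector of a cell is recorded by the set of its negative entries. *)
Definition cell S : set 'rV[R]_n :=
  [set x | forall k, 0 < (-1) ^+ (k \in S) * affine_form (a k) (b k) x].

Lemma cell_segment S x y t : cell S x -> cell S y -> 0 <= t <= 1 ->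
  cell S (x + t *: (y - x)).
Proof.
move=> Sx Sy t01 k; rewrite affine_form_segment mulrDr !(mulrCA (_ ^+ _)).
exact: convex_comb_gt0.
Qed.

(** A nonempty cell is convex, hence a union of segments sharing the endpoint [x]. *)
Lemma connected_cell S : connected (cell S).
Proof.
have [->|/set0P[x Sx]] := eqVneq (cell S) set0; first exact: connected0.
pose seg y := (fun t : R => x + t *: (y - x)) @` `[0, 1]%classic.
have -> : cell S = \bigcup_(y in cell S) seg y.
  apply/seteqP; split=> [y Sy|_ [y Sy] [t /= + <-]].
    by exists y => //; exists 1; rewrite /= ?in_itv /= ?ler01 ?lexx// scale1r subrKC.
  by rewrite in_itv /=; apply: cell_segment.
apply: bigcup_connected.
  by exists x => y _; exists 0; rewrite /= ?in_itv /= ?ler01 ?lexx// scale0r addr0.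
move=> y _; apply: connected_continuous_connected; first exact: segment_connected.
apply: continuous_subspaceT => t; apply: cvgD; first exact: cvg_cst.
exact: scalel_continuous.
Qed.

Lemma cell_complement S : cell S `<=` ~` \bigcup_k hyperplane k.
Proof. by move=> x Sx [k _] x0; have := Sx k; rewrite x0 mulr0 ltxx. Qed.

Lemma mem_cell x : (~` \bigcup_k hyperplane k) x ->
  cell [set k | affine_form (a k) (b k) x < 0]%SET x.
Proof.
move=> xh k; rewrite inE mulr_sign; case: ifPn => [|]; first by rewrite oppr_gt0.
rewrite -leNgt le_eqVlt => /predU1P[x0|//].
by case: xh; exists k.
Qed.

(** Intermediate values: the image of [C] is an interval missing 0. *)
Lemma connected_constant_sign (u : 'rV[R]_n) c C x y : connected C -> C x -> C y ->
  (forall z, C z -> affine_form u c z != 0) ->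
  0 < affine_form u c x -> 0 < affine_form u c y.
Proof.
move=> cC Cx Cy C0 x0; rewrite ltNge; apply/negP => y0.
have /connected_intervalP fI : connected (affine_form u c @` C).
  apply: connected_continuous_connected => //.
  exact/continuous_subspaceT/continuous_affine_form.
have [|z Cz z0] := fI _ _ (imageP _ Cy) (imageP _ Cx) 0; first by rewrite y0 ltW.
by have := C0 z Cz; rewrite z0 eqxx.
Qed.

Lemma connected_component_cell S x : cell S x ->
  connected_component (~` \bigcup_k hyperplane k) x = cell S.
Proof.
move=> Sx; apply/seteqP; split; last first.
  apply: connected_component_max => //; first exact: cell_complement.
  exact: connected_cell.
move=> y [C [Cx Ch cC] Cy] k.
have Ck z : C z -> affine_form (a k) (b k) z != 0.
  by move=> /Ch Cz; apply/eqP => z0; apply: Cz; exists k.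
have := Sx k; rewrite !mulr_sign; case: (k \in S); last first.
  exact: (connected_constant_sign cC Cx Cy Ck).
(* For a negative sign, argue by contraposition, carrying positivity from [y] back to [x]. *)
rewrite !oppr_gt0 !ltNge !le_eqVlt ![0 == _]eq_sym.
rewrite (negbTE (Ck _ Cx)) (negbTE (Ck _ Cy)) /=.
by apply: contra; apply: (connected_constant_sign cC Cy Cx Ck).
Qed.

Lemma regionsE : regions hyperplane = [set C | C !=set0 /\ exists S, C = cell S].
Proof.
apply/seteqP; split=> [_ [x xh <-]|_ [/[swap] [[S ->]] [x Sx]]] /=.
  have Sx := mem_cell xh.
  by rewrite (connected_component_cell Sx); split; [exists x|eexists].
by exists x; [exact: cell_complement|exact: connected_component_cell].
Qed.

Lemma cell_inj S T : cell S !=set0 -> cell S = cell T -> S = T.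
Proof.
move=> [x Sx] ST; have := Sx; rewrite ST => Tx.
apply/setP => k; have := Sx k; have := Tx k; rewrite !mulr_sign.
by case: (k \in S); case: (k \in T) => //; lra.
Qed.

(** [separates] allows any equation of the hyperplane, so the forward direction is geometric: a
    segment between separated points crosses it, whereas an affine form of equal sign at both ends
    has no zero between them. *)
Lemma separates_cell k S T : a k != 0 -> cell S !=set0 -> cell T !=set0 ->
  separates (hyperplane k) (cell S) (cell T) <-> (k \in S) != (k \in T).
Proof.
move=> ak0 [x Sx] [y Ty]; split.
  move=> [u [c [u0 hE Su Tu]]]; apply/negP => /eqP ST.
  have ux := Su x Sx; have uy := Tu y Ty; rewrite /= in ux uy.
  have d0 : 0 < dotr u y - dotr u x by lra.
  (* The parameter at which the segment from [x] to [y] reaches the value [c]. *)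
  pose t := (c - dotr u x) / (dotr u y - dotr u x).
  have t01 : 0 <= t <= 1.
    by rewrite divr_ge0 ?ler_pdivrMr //=; lra.
  have : hyperplane k (x + t *: (y - x)).
    rewrite hE /= -[- x]scaleN1r !dotrDZ mulN1r mulrBr.
    by rewrite -mulrBr /t divfK ?gt_eqF//; ring.
  rewrite /hyperplane /= affine_form_segment => xy0.
  have := Sx k; have := Ty k; rewrite -ST; set s := (-1) ^+ _ => sy sx.
  have := convex_comb_gt0 sx sy t01.
  by rewrite !(mulrCA _ s) -mulrDr xy0 mulr0 ltxx.
(* Exchanging the two cells amounts to negating the normal and the offset. *)
wlog kS : S T x y Sx Ty / k \in S => [wl kST|].
  have [kS|kS] := boolP (k \in S); first exact: (wl _ _ x y).
  have kT : k \in T by move: kST; rewrite (negbTE kS); case: (k \in T).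
  rewrite eq_sym in kST; have [u [c [u0 hE Tu Su]]] := wl T S y x Ty Sx kT kST.
  exists (- u), (- c); split=> [| | z /Su | z /Tu] /=.
  - by rewrite oppr_eq0.
  - by rewrite hE; apply/seteqP; split=> z /=; rewrite dotrNl; lra.
  - by rewrite dotrNl ltrN2.
  - by rewrite dotrNl ltrN2.
rewrite kS; case: (boolP (k \in T)) => // kT _.
exists (a k), (- b k); split=> // [|z /(_ k)|z /(_ k)].
- apply/seteqP; split=> z; rewrite /hyperplane /affine_form /=; lra.
- by rewrite kS mulr_sign /affine_form /=; lra.
- by rewrite (negbTE kT) mulr_sign /affine_form /=; lra.
Qed.

Lemma sep_cell S T : (forall k, a k != 0) -> cell S !=set0 -> cell T !=set0 ->
  sep hyperplane (cell S) (cell T) = (S :\: T :|: (T :\: S))%SET.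
Proof.
move=> a0 S0 T0; apply/setP => k; rewrite !inE.
apply/asboolP/idP => [/separates_cell|]; last first.
  by move=> kST; apply/separates_cell => //; case: (k \in S) (k \in T) kST => -[].
by move=> /(_ (a0 k) S0 T0); case: (k \in S) (k \in T) => -[].
Qed.

End Arrangement.

(** * Facet hyperplanes of a simplex *)

(** Affine independence makes the matrix [M] with rows (1, v k) invertible; the coordinates of [x]
    are the entries of (1, x) times the inverse of [M], hence affine in [x]. *)
Lemma barycentric_coordinates (R : realType) (n : nat) (v : 'I_n.+1 -> 'rV[R]_n) :
  affinely_independent v ->
  exists (u : 'I_n.+1 -> 'rV[R]_n) (c : 'I_n.+1 -> R), forall x,
    \sum_k affine_form (u k) (c k) x = 1 /\
    \sum_k affine_form (u k) (c k) x *: v k = x.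
Proof.
move=> indep.
pose M : 'M[R]_(1 + n) := row_mx (const_mx 1) (\matrix_(k < 1 + n) v k).
have mulM (w : 'rV[R]_(1 + n)) :
    w *m M = row_mx (\sum_k w ord0 k)%:M (\sum_k w ord0 k *: v k).
  rewrite mul_mx_row; congr row_mx.
    apply/rowP => j; rewrite ord1 !mxE eqxx mulr1n.
    by apply: eq_bigr => k _; rewrite mxE mulr1.
  by rewrite mulmx_sum_row; apply: eq_bigr => k _; rewrite rowK.
have unitM : M \in unitmx.
  rewrite -row_free_unit -kermx_eq0; apply/rowV0P => w /sub_kermxP.
  rewrite mulM -[0 in RHS]row_mx0 => /eq_row_mx[/matrixP/(_ ord0 ord0)].
  rewrite !mxE eqxx mulr1n => w1 wv; apply/rowP => k; rewrite mxE.
  exact: (indep (fun k => w ord0 k)).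
pose N : 'M[R]_(1 + n) := invmx M.
(* The first row of [N] holds the constants; the columns below it are the normals. *)
exists (fun k => (col k (dsubmx N))^T), (fun k => usubmx N ord0 k) => x.
have formE k : affine_form ((col k (dsubmx N))^T) (usubmx N ord0 k) x =
    (row_mx 1%:M x *m N) ord0 k.
  rewrite -[N]vsubmxK mul_row_col mul1mx col_mxKu col_mxKd [RHS]mxE addrC; congr (_ + _).
  by rewrite mxE; apply: eq_bigr => i _; rewrite !mxE mulrC.
have := mulM (row_mx 1%:M x *m N); rewrite -mulmxA mulVmx // mulmx1.
case/eq_row_mx => /matrixP/(_ ord0 ord0).
rewrite !mxE eqxx !mulr1n => lam1 lamx; split.
  by rewrite lam1; apply: eq_bigr => k _; rewrite formE.
by rewrite [RHS]lamx; apply: eq_bigr => k _; rewrite formE.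
Qed.

Section Simplex.
Variables (R : realType) (n : nat) (v : 'I_n.+1 -> 'rV[R]_n).
Variables (u : 'I_n.+1 -> 'rV[R]_n) (c : 'I_n.+1 -> R).
Hypothesis indep : affinely_independent v.
Hypothesis bary : forall x,
  \sum_k affine_form (u k) (c k) x = 1 /\
  \sum_k affine_form (u k) (c k) x *: v k = x.

Local Notation lam k x := (affine_form (u k) (c k) x).

Lemma barycentric_unique (w : 'I_n.+1 -> R) k :
  \sum_i w i = 1 -> lam k (\sum_i w i *: v i) = w k.
Proof.
move=> w1; set x := \sum_i _; have [lam1 lamx] := bary x.
apply/eqP; rewrite -subr_eq0; apply/eqP.
apply: (indep (a := fun i => lam i x - w i)).
  by rewrite sumrB lam1 w1 subrr.
under eq_bigr do rewrite scalerBl.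
by rewrite sumrB lamx subrr.
Qed.

Lemma affine_span_opposite k : affine_span v (~: [set k])%SET = hyperplane u c k.
Proof.
apply/seteqP; split=> [x [w [w1 ->]]|x /= xk].
  (* Extended by 0 at [k], the weights are the barycentric coordinates of the point. *)
  pose w0 i := if i \in (~: [set k])%SET then w i else 0.
  have -> : \sum_(i in (~: [set k])%SET) w i *: v i = \sum_i w0 i *: v i.
    rewrite big_mkcond; apply: eq_bigr => i _.
    by rewrite /w0; case: ifP => //; rewrite scale0r.
  by rewrite /hyperplane /= barycentric_unique /w0 -?big_mkcond// !inE eqxx.
have [lam1 lamx] := bary x; exists (fun i => lam i x).
have inC i : (i \in (~: [set k])%SET) = (i != k) by rewrite !inE.
rewrite !(eq_bigl _ _ inC); split.
  by rewrite -[RHS]lam1 [RHS](bigD1 k) //= xk add0r.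
by rewrite -[LHS]lamx (bigD1 k) //= xk scale0r add0r.
Qed.

Lemma convex_spanE : convex_span v = [set x | forall k, 0 <= lam k x].
Proof.
apply/seteqP; split=> [x [w [w0 w1 ->]] k|x x0].
  by rewrite barycentric_unique.
by have [lam1 lamx] := bary x; exists (fun k => lam k x); split.
Qed.

(** A zero normal makes the coordinate constant, yet it is 1 at vertex [k] and 0 at any other
    vertex; [0 < n] provides one. *)
Lemma barycentric_normal_neq0 k : (0 < n)%N -> u k != 0.
Proof.
move=> n0; apply/eqP => uk0.
have const x : lam k x = c k.
  by rewrite /affine_form uk0 /dotr big1 ?add0r// => i _; rewrite mxE mul0r.
have vertex j : lam k (\sum_i (i == j)%:R *: v i) = (k == j)%:R.
  apply: (barycentric_unique (w := fun i => (i == j)%:R)).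
  by rewrite (bigD1 j) //= eqxx big1 ?addr0// => i /negbTE ->.
have := vertex k; rewrite const -(const (\sum_i (i == lift k (Ordinal n0))%:R *: v i)).
by rewrite vertex eqxx (negbTE (neq_lift _ _)) => /eqP; rewrite eq_sym oner_eq0.
Qed.

Lemma simplex_cell_nonempty (S : {set 'I_n.+1}) :
  cell u c S !=set0 <-> S != [set: 'I_n.+1]%SET.
Proof.
split=> [[x Sx]|ST].
  apply/eqP => ST; have [lam1 _] := bary x.
  (* Coordinates that are all negative cannot sum to 1. *)
  have : 0 <= \sum_k - lam k x.
    by apply: sumr_ge0 => k _; have := Sx k; rewrite ST inE mulr_sign => /ltW.
  by rewrite sumrN lam1 ler0N1.
have C0 : 0 < (#|~: S|%SET%:R : R).
  rewrite ltr0n lt0n cards_eq0; apply: contra ST => /eqP S0.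
  by rewrite -[S]finset.setCK S0 finset.setC0.
(* Weight -1 on [S]; the complement shares 1 + #|S| equally, which brings the total to 1. *)
pose w i : R := if i \in S then -1 else (1 + #|S|%:R) / #|~: S|%SET%:R.
have w1 : \sum_i w i = 1.
  rewrite (bigID (mem S)) /= (eq_bigr (fun=> -1)); last by move=> i; rewrite /w => ->.
  rewrite [X in _ + X](eq_bigr (fun=> (1 + #|S|%:R) / #|~: S|%SET%:R)); last first.
    by move=> i; rewrite /w => /negbTE ->.
  rewrite sumr_const -(eq_bigl _ _ (fun i => finset.in_setC i S)) sumr_const.
  by rewrite -[X in _ + X]mulr_natr divfK ?gt_eqF// mulNrn addrC addrK.
exists (\sum_i w i *: v i) => k; rewrite barycentric_unique// mulr_sign /w.
by case: (k \in S); [rewrite opprK|rewrite divr_gt0// ltr_pwDl].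
Qed.

Lemma interior_convex_span : (0 < n)%N -> interior (convex_span v) = cell u c finset.set0.
Proof.
move=> n0; apply/seteqP; split=> x; last first.
  move=> x0.
  have x0' k : 0 < lam k x by have := x0 k; rewrite inE mulr_sign.
  rewrite convex_spanE /interior /=.
  have : \forall y \near x, forall k, 0 < lam k y.
    apply: (@filter_forall _ _ (fun k y => 0 < lam k y) (nbhs x)) => k.
    exact: (@continuous_affine_form _ _ _ _ x [set r | 0 < r] (lt_nbhsr (x0' k))).
  by apply: filterS => y y0 k; rewrite ltW.
rewrite convex_spanE /interior /= => xint k; rewrite inE mulr_sign lt_neqAle.
have /= -> := nbhs_singleton xint k; rewrite andbT; apply/eqP => xk.
(* Where coordinate [k] vanishes, moving along [- u k] makes it negative, so no neighbourhood of [x]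
   stays in the simplex. *)
have line : (fun t : R => x + t *: (- u k)) @ (0 : R) --> x.
  rewrite -[X in _ --> X]addr0 -[X in _ --> x + X](scale0r (- u k)).
  apply: cvgD; first exact: cvg_cst.
  exact: scalel_continuous.
have /nbhs_ballP[e /= e0 xe] := line _ xint.
have /xe/(_ k) : ball (0 : R) e (e / 2).
  by rewrite /ball /= sub0r normrN gtr0_norm ?divr_gt0// ltr_pdivrMr//; lra.
have := dotr_gt0 (barycentric_normal_neq0 k n0).
move: xk; rewrite /affine_form -scaleN1r scalerA dotrDZ => xk uk.
have := mulr_gt0 e0 uk; lra.
Qed.

End Simplex.

Theorem mainTheorem6 (R : realType) (v : 'I_4 -> 'rV[R]_3)
    (hv : regular_tetrahedron v) :
  (exists reg : 'I_15 -> set 'rV[R]_3, region_ordering v reg) /\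
  (forall reg : 'I_15 -> set 'rV[R]_3, region_ordering v reg ->
     smith_normal_form_with (varchenko (face_plane v) reg)
       (D_tetra : 'M[{poly int}]_15) (P_tetra : 'M[{poly int}]_15)
       (P_tetra^T : 'M[{poly int}]_15)).
Proof.
have [indep _] := hv; have [u [c bary]] := barycentric_coordinates indep.
have planeE : face_plane v = hyperplane u c.
  by apply/funext => k; apply: affine_span_opposite.
have intE : tetra_interior v = cell u c finset.set0 by apply: interior_convex_span.
have u0 k : u k != 0 by apply: (barycentric_normal_neq0 indep bary).
have cell0 := simplex_cell_nonempty indep bary.
have int0 : cell u c finset.set0 !=set0.
  by apply/cell0; apply/eqP => /setP/(_ ord0); rewrite !inE.
have label0 i : cell u c (region_label i) !=set0 by apply/cell0/region_label_neqT.
have sep_int S : cell u c S !=set0 ->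
    sep (hyperplane u c) (cell u c finset.set0) (cell u c S) = S.
  by move=> S0; rewrite sep_cell// finset.set0D finset.setD0 finset.set0U.
split.
  exists (fun i => cell u c (region_label i)).
  rewrite /region_ordering planeE regionsE intE; split.
  - split=> [i _|i j _ _ /(cell_inj (label0 i))/region_label_inj //|].
      by split=> //; exists (region_label i).
    move=> _ [/[swap] [[S ->]]] /cell0/region_label_surj[i <-].
    by exists i.
  - by congr cell; apply/setP => k; rewrite !inE.
  - by move=> i; rewrite sep_int.
move=> reg [[reg_fun _ _] _ reg_label].
(* Labels determine the regions: [reg i] is the cell of some [S], and [S] is the set of planes
   separating it from the interior, that is, the label of [i]. *)
have regE i : reg i = cell u c (region_label i).
  have : regions (face_plane v) (reg i) by apply: reg_fun.
  rewrite planeE regionsE => -[+ [S regS]].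
  rewrite regS => S0; congr cell.
  by rewrite -(reg_label i) regS planeE intE sep_int.
have varE : varchenko (face_plane v) reg =
    region_kernel (fun a b => if a == b then 1 else 'X).
  apply/matrixP => i j.
  by rewrite !mxE !regE planeE sep_cell// tensor_symdiff.
split.
- exact: is_diag_D_tetra.
- exact: dvd_D_tetra.
- exact: unit_P_tetra.
- by rewrite unitmx_tr unit_P_tetra.
- by rewrite varE mxdiag_varchenko.
Qed.
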